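(* Let $k$ be an algebraically closed field of characteristic $p>0$. The precise list of all numbers that can and do occur as the $F$-pure threshold of a reduced homogeneous polynomial of degree $4$ in $k[x,y]$ is as follows: (a) in every characteristic $p$, the generic value of the $F$-pure threshold is $\frac12$; (b) if $p=2$, all reduced polynomials of degree $4$ have $F$-pure threshold $\frac12$; (c) if $p\neq 2$, then there are also reduced polynomials of degree $4$ with $F$-pure threshold $\frac{p-1}{2p}$ (the truncation $\langle\frac12\rangle_1$). That is, the set of values is $\{\frac12\}$ if $p=2$ and $\{\frac12,\frac{p-1}{2p}\}$ if $p\ne2$.
   Context: A nonzero homogeneous polynomial is reduced if it has no repeated irreducible factors. For a nonzero homogeneous $f\in k[x,y]$ of positive degree, $\mathrm{fpt}(f)=\sup\{N/p^e : f^N\notin (x^{p^e},y^{p^e})\}=\inf\{N/p^e: f^N\in(x^{p^e},y^{p^e})\}$. The generic value is the maximal value of $\mathrm{fpt}$ on the projective space of degree $4$ forms in $k[x,y]$; it is attained exactly on a dense Zariski-open subset (which contains reduced polynomials). $\langle\lambda\rangle_e$ is the truncation at the $e$-th place of the non-terminating base $p$ expansion of $\lambda$. *)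

(* Defs.v *)
From HB Require Import structures.
From mathcomp Require Import all_boot all_order all_algebra.
From mathcomp Require Import mpoly.
From mathcomp Require Import classical_sets reals.

Set Implicit Arguments.
Unset Strict Implicit.
Unset Printing Implicit Defensive.

Import Order.TTheory GRing.Theory Num.Theory.
Local Open Scope classical_set_scope.
Local Open Scope ring_scope.

(* k[x,y] is {mpoly k[2]}, with x = 'X_0 and y = 'X_1. *)

(* f \in (x^q, y^q) *)
Definition in_xy_pow (k : fieldType) (q : nat) (f : {mpoly k[2]}) : Prop :=
  exists g h : {mpoly k[2]}, f = g * 'X_0 ^+ q + h * 'X_1 ^+ q.

(* Meaningful when f is nonzero and homogeneous of positive degree and
   p = char k > 0: the set is then nonempty and bounded above, so that [sup]
   is its least upper bound. *)
Definition fpt (R : realType) (k : fieldType) (p : nat) (f : {mpoly k[2]}) : R :=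
  sup [set r : R | exists N e : nat,
         ~ in_xy_pow (p ^ e) (f ^+ N) /\ r = N%:R / (p ^ e)%:R].

Definition irreducible_mpoly (k : fieldType) (g : {mpoly k[2]}) : Prop :=
  [/\ g != 0, g \isn't a GRing.unit
    & forall a b : {mpoly k[2]},
        g = a * b -> a \is a GRing.unit \/ b \is a GRing.unit].

Definition reduced (k : fieldType) (f : {mpoly k[2]}) : Prop :=
  f != 0 /\
  forall g : {mpoly k[2]}, irreducible_mpoly g ->
    ~ exists h : {mpoly k[2]}, f = g ^+ 2 * h.

(* Subsets of the projective space of degree d forms in k[x,y] are represented
   by sets of nonzero forms (the corresponding punctured cones). *)
Definition nonzero_form (k : fieldType) (d : nat) (f : {mpoly k[2]}) : Prop :=
  f != 0 /\ f \is d.-homog.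

(* The homogeneous coordinates of a form: the i-th one is its coefficient of
   x^i y^(d-i). *)
Definition form_coeff (k : fieldType) (d : nat) (f : {mpoly k[2]})
    (i : 'I_d.+1) : k :=
  f@_(U_(0%R) *+ i + U_(1%R) *+ (d - i)%N)%MM.

(* The complement, among nonzero forms, of the common zero locus of a set of
   homogeneous polynomials in the coefficients. *)
Definition zariski_open (k : fieldType) (d : nat) (U : set {mpoly k[2]}) : Prop :=
  exists S : set {mpoly k[d.+1]},
    (forall P, S P -> exists m : nat, P \is m.-homog) /\
    forall f, U f <->
      nonzero_form d f /\ exists2 P, S P & P.@[@form_coeff k d f] != 0.

Definition zariski_dense (k : fieldType) (d : nat) (U : set {mpoly k[2]}) : Prop :=
  forall V : set {mpoly k[2]}, zariski_open d V -> (exists f, V f) ->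
    exists f, V f /\ U f.

(* v is the maximum of fpt over the forms of degree d, and is attained exactly
   on a dense open subset. *)
Definition is_generic_fpt (R : realType) (k : fieldType) (p d : nat) (v : R) : Prop :=
  let locus := [set f : {mpoly k[2]} | nonzero_form d f /\ fpt R p f = v] in
  [/\ exists f, locus f,
      forall f : {mpoly k[2]}, nonzero_form d f -> fpt R p f <= v,
      zariski_open d locus
    & zariski_dense d locus].

(* [a i] is the digit at place i.+1 of the base p expansion
   lam = \sum_(i >= 0) a i / p ^ i.+1, which is required to be non-terminating;
   such an expansion exists, and is unique, exactly for 0 < lam <= 1. *)
Definition nonterminating_expansion (R : realType) (p : nat) (lam : R)
    (a : nat -> nat) : Prop :=
  [/\ forall i, (a i < p)%N,
      forall n, exists2 m, (n <= m)%N & a m != 0%N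
    & forall eps : R, 0 < eps -> exists n0 : nat, forall n, (n0 <= n)%N ->
        `|\sum_(i < n) (a i)%:R / p%:R ^+ i.+1 - lam| < eps].

(* t = <lam>_e *)
Definition is_truncation (R : realType) (p : nat) (lam : R) (e : nat) (t : R) : Prop :=
  exists2 a : nat -> nat, nonterminating_expansion p lam a &
    t = \sum_(i < e) (a i)%:R / p%:R ^+ i.+1.

(* Main.v *)
Require Import Defs.
From HB Require Import structures.
From mathcomp Require Import all_boot all_order all_algebra.
From mathcomp Require Import zify ring lra.
From mathcomp Require Import mpoly.
From mathcomp Require Import boolp classical_sets reals.

Set Implicit Arguments.
Unset Strict Implicit.
Unset Printing Implicit Defensive.

Import Order.TTheory GRing.Theory Num.Theory.
Local Open Scope classical_set_scope.
Local Open Scope ring_scope.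

(* A form f of degree d is encoded by F(X) = f(X, 1); then f lies in (x^q, y^q)
   iff the coefficients F_a with a < q and d - a < q vanish.  Since q = p^e,
   4N >= 2q - 1 forces f^N in (x^q, y^q), whence fpt f <= 1/2.
   For p = 2m + 1, let H(f) be the coefficient of (xy)^(p-1) in f^m.  Up to a
   power of H(f), f^((q-1)/2) has the monomial (xy)^(q-1), so fpt f = 1/2 when
   H(f) <> 0, and fpt f <= m/p when H(f) = 0.  In the latter case, suppose that
   f is reduced and N is minimal with f^N in I = (x^q, y^q).  Derivations
   preserve I, and f_x, f_y are coprime cubics, hence generate all forms of
   degree 5; if p does not divide N, f^(N-1) is multiplied into I by all of
   these, which forces 4N > 2q - 3.  So p divides N when q > p, and flatness of
   Frobenius reduces to q = p: thus fpt f = m/p.  The family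
   x^4 + c x^2 y^2 + y^4, for which H is a Legendre polynomial in c, provides
   both kinds of reduced forms.
   For p = 2, fpt f = 1/2 iff f^3 is not in (x^8, y^8) iff the reductions modulo
   2 of the invariants I and J of binary quartics do not both vanish; forms with
   I = J = 0 have a double root. *)

(** * Coefficients of Frobenius powers and the box condition *)

(** The second inequality is n - a < q in additive form. It also admits indices a > n, where the
    dehomogenization of a form of degree n has zero coefficients. *)
Definition box_vanishing (k : fieldType) (n q : nat) (F : {poly k}) : Prop :=
  forall a, (a < q)%N -> (n < q + a)%N -> F`_a = 0.

(** Frobenius is additive, so [G ^+ p] arises from [G] by raising the coefficients to the p-th power
    and substituting X^p for X. *)
Lemma coef_exp_pchar (k : fieldType) (p : nat) (hp : p \in [pchar k])
    (G : {poly k}) (i : nat) :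
  (G ^+ p)`_i = if (p %| i)%N then G`_(i %/ p) ^+ p else 0.
Proof.
have p_gt0 : (0 < p)%N by exact: prime_gt0 (pcharf_prime hp).
have hpX : p \in [pchar {poly k}] by rewrite pchar_poly.
suff -> : G ^+ p = map_poly (pFrobenius_aut hp) G \Po 'X^p.
  rewrite coef_comp_poly_Xn //; case: ifP => // _.
  by rewrite coef_map /= pFrobenius_autE.
elim/poly_ind: G => [|G c IH]; first by rewrite map_poly0 comp_poly0 expr0n gtn_eqF.
rewrite -(pFrobenius_autE hpX) rmorphD rmorphM /= !pFrobenius_autE IH.
rewrite rmorphD rmorphM /= map_polyX map_polyC comp_polyD comp_polyM comp_polyX.
by rewrite comp_polyC /= pFrobenius_autE polyC_exp.
Qed.

Lemma coef_exp_pcharM (k : fieldType) (p : nat) (hp : p \in [pchar k])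
    (G : {poly k}) (i : nat) : (G ^+ p)`_(p * i) = G`_i ^+ p.
Proof.
have p_gt0 : (0 < p)%N by exact: prime_gt0 (pcharf_prime hp).
by rewrite coef_exp_pchar // dvdn_mulr // mulKn.
Qed.

(** Flatness of Frobenius in monomial terms: [F ^+ p] has only exponents divisible by p, and both
    box inequalities scale by p. *)
Lemma box_vanishing_frobenius (k : fieldType) (p : nat) (hp : p \in [pchar k])
    (n q : nat) (F : {poly k}) :
  box_vanishing n q F <-> box_vanishing (p * n) (p * q) (F ^+ p).
Proof.
have p_gt0 : (0 < p)%N by exact: prime_gt0 (pcharf_prime hp).
split=> h a ha1 ha2.
  rewrite coef_exp_pchar //; case: ifP => // /dvdnP [b E].
  move: ha1 ha2; rewrite {}E mulnC ltn_pmul2l // -mulnDr ltn_pmul2l // => hb1 hb2.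
  by rewrite mulKn // h // expr0n gtn_eqF.
have := h (p * a)%N; rewrite coef_exp_pcharM // ltn_pmul2l // -mulnDr ltn_pmul2l //.
by move=> /(_ ha1 ha2)/eqP; rewrite expf_eq0 p_gt0 => /eqP.
Qed.

(** The exponents of [G ^+ p] are multiples of p, and up to the degree 2p - 2 allowed for [W] only p
    - 1 has the right residue, so a single product survives. *)
Lemma coef_exp_pcharMr (k : fieldType) (p : nat) (hp : p \in [pchar k])
    (G W : {poly k}) (n : nat) : (size W <= p.*2.-1)%N ->
  (G ^+ p * W)`_(p * n + p.-1) = G`_n ^+ p * W`_p.-1.
Proof.
have p_gt0 : (0 < p)%N by exact: prime_gt0 (pcharf_prime hp).
move=> sW; rewrite coefM.
have hpn : (p * n < (p * n + p.-1).+1)%N by lia.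
rewrite (bigD1 (Ordinal hpn)) //= coef_exp_pcharM // addKn big1 ?addr0 //.
move=> [j hj] /=; rewrite -val_eqE /= => ne.
rewrite coef_exp_pchar //; case: ifP => [/dvdnP [b E]|]; last by rewrite mul0r.
rewrite [W`__]nth_default ?mulr0 //; apply: leq_trans sW _.
move: ne hj; rewrite E [(b * p)%N]mulnC eqn_pmul2l // => ne hj.
have hb : (b < n)%N.
  rewrite ltn_neqAle ne -ltnS -(ltn_pmul2l p_gt0) mulnS; lia.
have : (p * b + p <= p * n)%N by rewrite -mulnSr leq_pmul2l.
lia.
Qed.

(** With q = p^e, (pq - 1)/2 = p(q - 1)/2 + m and pq - 1 = p(q - 1) + (p - 1), so the coefficient at
    level pq is H times the p-th power of the one at level q. The degree of [F ^+ m] is at most 4m =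
    2p - 2. *)
Lemma ordinary_coef (k : fieldType) (p : nat) (hp : p \in [pchar k])
    (F : {poly k}) (m e : nat) : p = m.*2.+1 -> (size F <= 5)%N ->
  (F ^+ m)`_p.-1 != 0 -> (F ^+ (p ^ e)./2)`_(p ^ e).-1 != 0.
Proof.
move=> pE sF H0; have p_gt0 : (0 < p)%N by rewrite pE.
have oddq n : odd (p ^ n) by rewrite oddX pE /= odd_double orbT.
elim: e => [|e IH]; first by rewrite expn0 /= expr0 coefC oner_eq0.
have qE := odd_double_half (p ^ e); rewrite oddq /= in qE.
rewrite expnS; move: IH qE; set t := (_ ./2); move: t (p ^ e)%N => t q IH qE.
have -> : ((p * q)./2 = t * p + m)%N.
  by rewrite (_ : (p * q)%N = true + (t * p + m).*2)%N ?half_bit_double //; nia.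
have -> : ((p * q).-1 = p * q.-1 + p.-1)%N by nia.
rewrite exprD exprM coef_exp_pcharMr //.
  by rewrite mulf_neq0 // expf_neq0.
apply: leq_trans (size_poly_exp_leq _ _) _; nia.
Qed.

(** * Lowering the exponent by derivations *)

(** Affine version of the fact that two coprime binary forms of degree d generate all forms of
    degree 2d - 1; the size disjunction excludes a common zero at infinity. A Bezout relation is
    reduced modulo the polynomial of full degree. *)
Lemma coprimep_lin_comb (k : fieldType) (d : nat) (P Q T : {poly k}) :
    coprimep P Q -> (size P <= d.+1)%N -> (size Q <= d.+1)%N ->
    (size P == d.+1) || (size Q == d.+1) -> (size T <= d.*2)%N ->
  exists u v : {poly k},
    [/\ (size u <= d)%N, (size v <= d)%N & T = u * P + v * Q].
Proof.
wlog sP : P Q / size P == d.+1.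
  move=> W cPQ sP sQ /orP [h|h] sT; first by apply: W => //; rewrite h.
  have cQP : coprimep Q P by rewrite coprimep_sym.
  have hor : (size Q == d.+1) || (size P == d.+1) by rewrite h.
  have [u [v [su sv ->]]] := W Q P h cQP sQ sP hor sT.
  by exists v, u; rewrite addrC.
move=> cPQ _ sQ _ sT.
have P0 : P != 0 by rewrite -size_poly_gt0 (eqP sP).
have [[u0 v0] /= E0] := Bezout_eq1_coprimepP P Q cPQ.
set v := (T * v0) %% P.
have sv : (size v <= d)%N by rewrite -ltnS -(eqP sP) ltn_modpN0.
have : P %| (T - v * Q).
  have -> : T - v * Q = (T * u0 + (T * v0) %/ P * Q) * P.
    have /eqP := divp_eq (T * v0) P; rewrite -/v addrC -subr_eq => /eqP <-.
    move: (_ %/ P) => w; transitivity (T * 1 - (T * v0 - w * P) * Q).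
      by rewrite mulr1.
    by rewrite -E0; ring.
  exact: dvdp_mulIr.
move=> /dvdpP [u Eu]; exists u, v; split=> //; last by rewrite -Eu subrK.
have [->|u0'] := eqVneq u 0; first by rewrite size_poly0.
have : (size (u * P)%R <= d.*2)%N.
  rewrite -Eu (leq_trans (size_polyD _ _)) // geq_max sT size_polyN.
  have [->|v1] := eqVneq v 0; first by rewrite mul0r size_poly0.
  rewrite (leq_trans (size_polyMleq _ _)) //.
  by move: (size v) (size Q) sv sQ => a b; lia.
by rewrite size_mul // (eqP sP) addnS -addnn /= leq_add2r.
Qed.

Lemma mulrn_pchar_dvdn (k : fieldType) (p n : nat) (x : k) :
  p \in [pchar k] -> (p %| n)%N -> x *+ n = 0.
Proof.
by move=> hp; rewrite (dvdn_pcharf hp) => /eqP E; rewrite -mulr_natr E mulr0.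
Qed.

(* F' and, by Euler's formula, 4F - X F' are the values at (X, 1) of the partial
   derivatives of the form encoded by F.  The condition on their sizes says that
   these do not both vanish at (1 : 0). *)
Lemma box_vanishing_pred (k : fieldType) (p : nat) (hp : p \in [pchar k])
    (F : {poly k}) (q N : nat) :
    let P := F^`() in let Q := F *+ 4 - 'X * F^`() in
    coprimep P Q -> (size P <= 4)%N -> (size Q <= 4)%N ->
    (size P == 4%N) || (size Q == 4%N) ->
    (p %| q)%N -> ~~ (p %| N.+1)%N -> (4 * N.+1 + 3 <= q.*2)%N ->
  box_vanishing (4 * N.+1) q (F ^+ N.+1) -> box_vanishing (4 * N) q (F ^+ N).
Proof.
move=> P Q cPQ sP sQ sPQ pq pN Nq hG b b1 b2.
have natN : N.+1%:R != 0 :> k by rewrite -(dvdn_pcharf hp).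
set G := F ^+ N.+1 in hG.
have EP : G^`() = (F ^+ N * P) *+ N.+1 by rewrite deriv_exp mulrC.
have EQ : G *+ (4 * N.+1) - 'X * G^`() = (F ^+ N * Q) *+ N.+1.
  by rewrite EP /Q /G exprSr mulrBr mulrnBl !mulrnAr -mulrnA mulrCA.
have hP a : (a < q)%N -> (4 * N + 3 < q + a)%N -> (F ^+ N * P)`_a = 0.
  move=> a1 a2; have /(congr1 (fun H : {poly k} => H`_a)) := EP.
  rewrite coef_deriv coefMn -[RHS]mulr_natr => E.
  apply/eqP; rewrite -[_ == 0](mulIr_eq0 _ (mulIf natN)) -E; apply/eqP.
  (* At a + 1 = q the hypothesis on [G] gives nothing, but the factor a + 1 is zero in k. *)
  have [e|ne] := eqVneq a.+1 q; first by rewrite (mulrn_pchar_dvdn _ hp) ?e.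
  by rewrite hG ?mul0rn //; lia.
have hQ a : (a < q)%N -> (4 * N + 3 < q + a)%N -> (F ^+ N * Q)`_a = 0.
  move=> a1 a2; have /(congr1 (fun H : {poly k} => H`_a)) := EQ.
  rewrite coefB !coefMn coefXM coef_deriv -[RHS]mulr_natr => E.
  apply/eqP; rewrite -[_ == 0](mulIr_eq0 _ (mulIf natN)) -E; apply/eqP.
  have -> : (if a == 0%N then 0 else G`_a.-1.+1 *+ a.-1.+1) = G`_a *+ a.
    by case: (a) => //=; rewrite mulr0n.
  (* When 4(N + 1) = q + a the index lies just outside the box of [G]; the Euler factor 4(N + 1) - a
     is then q, which is zero in k. *)
  have [e|ne] := eqVneq (4 * N.+1)%N (q + a)%N.
    by rewrite e mulrnDr addrK (mulrn_pchar_dvdn _ hp).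
  by rewrite hG ?mul0rn ?subrr //; lia.
(* The least j for which the indices b + j - i with i <= 2 satisfy the lower bound in [hP] and [hQ]
   (truncated to 0 if b already suffices). It is at most 5 since q + b > 4N, and 4N + 7 <= 2q keeps
   b + j < q. *)
set j := (4 * N + 6 - (q + b))%N.
have sj : (size ('X^j : {poly k}) <= 3.*2)%N by rewrite size_polyXn /j; lia.
have [u [v [su sv E]]] := coprimep_lin_comb cPQ sP sQ sPQ sj.
have : (F ^+ N * 'X^j)`_(b + j) = 0.
  rewrite E mulrDr coefD ![F ^+ N * (_ * _)]mulrCA !coefM.
  rewrite !big1 ?addr0 // => [] [i hi] _ /=.
    have [h|h] := leqP 3 i; first by rewrite nth_default ?mul0r // (leq_trans sv).
    by rewrite hQ ?mulr0 //; rewrite /j; lia.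
  have [h|h] := leqP 3 i; first by rewrite nth_default ?mul0r // (leq_trans su).
  by rewrite hP ?mulr0 //; rewrite /j; lia.
by rewrite coefMXn ltnNge leq_addl /= addnK.
Qed.

(** The conclusion is m/p <= N/p^e. Descent: if p divides N, Frobenius reduces to e - 1; otherwise
    [box_vanishing_pred] lowers N by one, and N = 0 is impossible since 1 is not in the ideal. *)
Lemma box_vanishing_lower (k : fieldType) (p : nat) (hp : p \in [pchar k])
    (F : {poly k}) (m e N : nat) :
    let P := F^`() in let Q := F *+ 4 - 'X * F^`() in
    coprimep P Q -> (size P <= 4)%N -> (size Q <= 4)%N ->
    (size P == 4%N) || (size Q == 4%N) -> p = m.*2.+1 -> (0 < m)%N ->
  box_vanishing (4 * N) (p ^ e) (F ^+ N) -> (m * p ^ e <= p * N)%N.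
Proof.
move=> P Q cPQ sP sQ sPQ pE m0.
have p_gt0 : (0 < p)%N by rewrite pE.
have not0 q : (0 < q)%N -> ~ box_vanishing (4 * 0) q (F ^+ 0).
  move=> q0 /(_ 0%N q0); rewrite muln0 addn0 q0 => /(_ isT)/eqP.
  by rewrite expr0 coefC oner_eq0.
elim: e N => [|e IHe] N.
  case: N => [|N]; first by rewrite expn0 => /not0; case.
  by rewrite expn0 muln1 pE mulnS; lia.
elim: N => [|N IHN]; first by move=> /not0; rewrite expn_gt0 p_gt0; case.
move=> h; rewrite leqNgt; apply/negP => lt.
rewrite expnS mulnCA ltn_pmul2l // in lt.
have [/dvdnP [M E]|pN] := boolP (p %| N.+1)%N.
  have h' : box_vanishing (p * (4 * M)) (p * p ^ e) ((F ^+ M) ^+ p).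
    by rewrite -exprM -expnS mulnCA [(p * M)%N]mulnC -E.
  have := IHe M (proj2 (box_vanishing_frobenius hp _ _ _) h').
  by rewrite [(p * M)%N]mulnC -E leqNgt lt.
have hle : (4 * N.+1 + 3 <= (p ^ e.+1).*2)%N.
  have -> : ((p ^ e.+1).*2 = 4 * (m * p ^ e) + (p ^ e).*2)%N by rewrite expnS pE; nia.
  have : (0 < p ^ e)%N by rewrite expn_gt0 p_gt0.
  by lia.
have := IHN (box_vanishing_pred hp cPQ sP sQ sPQ _ pN hle h).
rewrite expnS dvdn_mulr // mulnCA leq_pmul2l // => /(_ isT); lia.
Qed.

(** * Quartics in characteristic 2 and the invariants I and J *)

Lemma coefM_quartic (k : fieldType) (F G : {poly k}) (n : nat) :
  (size F <= 5)%N -> (G * F)`_n.+4 =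
    F`_0 * G`_n.+4 + F`_1 * G`_n.+3 + F`_2 * G`_n.+2 + F`_3 * G`_n.+1 + F`_4 * G`_n.
Proof.
move=> sF; have E : F = \sum_(i < 5) F`_i *: 'X^i.
  rewrite -(poly_def 5 (fun i => F`_i)); apply/polyP => i; rewrite coef_poly.
  by case: ltnP => // h; rewrite nth_default // (leq_trans sF).
rewrite {1}E mulr_sumr coef_sum !big_ord_recl big_ord0 addr0 /= !addrA.
by rewrite -!scalerAr !coefZ !coefMXn /= !subSS !subn0.
Qed.

(** In F (F^N)^2 the square has no odd exponents, so the shape (a1 A, B, a3 A) of three consecutive
    coefficients reproduces itself. It starts from [F] with A = 1 and B = a2. *)
Lemma char2_quartic_step (k : fieldType) (F : {poly k}) (N n : nat) (A B : k) :
    let a i := F`_i in let A' := B ^+ 2 + a 1 * a 3 * A ^+ 2 in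
    2%N \in [pchar k] -> (size F <= 5)%N ->
    (F ^+ N)`_n.+1 = a 1 * A -> (F ^+ N)`_n.+2 = B -> (F ^+ N)`_n.+3 = a 3 * A ->
  [/\ (F ^+ (2 * N).+1)`_(2 * n).+4.+1 = a 1 * A',
      (F ^+ (2 * N).+1)`_(2 * n).+4.+2
        = a 2 * B ^+ 2 + (a 0 * a 3 ^+ 2 + a 4 * a 1 ^+ 2) * A ^+ 2
    & (F ^+ (2 * N).+1)`_(2 * n).+4.+3 = a 3 * A'].
Proof.
move=> a A' h2 sF h1 hB h3.
have Ev i : (F ^+ N ^+ 2)`_(2 * i) = (F ^+ N)`_i ^+ 2 by rewrite coef_exp_pcharM.
have Od i : (F ^+ N ^+ 2)`_(2 * i).+1 = 0.
  by rewrite coef_exp_pchar // dvdn2 /= oddM.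
rewrite exprSr mulnC exprM !(coefM_quartic (F ^+ N ^+ 2)) //.
have E1 : ((2 * n).+2 = 2 * n.+1)%N by rewrite mulnS.
have E2 : ((2 * n).+4 = 2 * n.+2)%N by rewrite !mulnS.
have E3 : ((2 * n).+4.+2 = 2 * n.+3)%N by rewrite !mulnS.
rewrite E3 E2 E1 !Ev !Od h1 hB h3 /A' /a; split; ring.
Qed.

(* a2^2 + a1 a3 and a0 a3^2 + a4 a1^2 + a1 a2 a3 are the reductions modulo 2 of
   the invariants I and J of the binary quartic with coefficients a0, ..., a4. *)
Lemma char2_not_box_vanishing (k : fieldType) (F : {poly k}) (e : nat) :
    let a i := F`_i in
    2%N \in [pchar k] -> (size F <= 5)%N ->
    (a 2 ^+ 2 + a 1 * a 3 != 0)
      || (a 0 * a 3 ^+ 2 + a 4 * a 1 ^+ 2 + a 1 * a 2 * a 3 != 0) ->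
  ~ box_vanishing (4 * (2 ^ e).-1) (2 ^ e.+1) (F ^+ (2 ^ e).-1).
Proof.
move=> a h2 sF; set I := (_ + a 1 * a 3); set J := (_ + a 1 * a 2 * a 3) => IJ.
have aa (x : k) : x + x = 0 by exact: addrr_pchar2.
case: e => [|e].
  by move=> /(_ 0%N isT isT)/eqP; rewrite expr0 coefC oner_eq0.
(* The step (A, B) |-> (A', B') is Frobenius followed by a linear map of
   determinant J; if J = 0, then B' = a2 A', and B = a2 A implies A' = I A^2. *)
have [A [B [[h1 h2' h3] hAB]]] : exists A B : k,
    let n := (2 ^ e.+2 - 4)%N in let G := F ^+ (2 ^ e.+1).-1 in
    [/\ G`_n.+1 = a 1 * A, G`_n.+2 = B & G`_n.+3 = a 3 * A] /\
    (if J == 0 then B = a 2 * A /\ A != 0 else (A != 0) || (B != 0)).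
  elim: e => [|e [A [B [[h1 h2' h3] hAB]]]].
    exists 1, (a 2); rewrite expr1 !mulr1; split=> //.
    by case: ifP; rewrite ?oner_neq0.
  have [h1' h2'' h3'] := char2_quartic_step h2 sF h1 h2' h3.
  have q4 : (4 <= 2 ^ e.+2)%N by rewrite -[4%N]/(2 ^ 2)%N leq_exp2l.
  have q2 : (2 <= 2 ^ e.+1)%N by rewrite -{1}[2%N]/(2 ^ 1)%N leq_exp2l.
  have En : (2 ^ e.+3 - 4 = (2 * (2 ^ e.+2 - 4)).+4)%N by rewrite (expnS 2 e.+2); lia.
  have EN : ((2 ^ e.+2).-1 = (2 * (2 ^ e.+1).-1).+1)%N by rewrite (expnS 2 e.+1); lia.
  rewrite En EN; do 2 eexists; split.
    by split; [exact: h1'|exact: h2''|exact: h3'].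
  move: hAB; case: ifP => [/eqP J0 [-> A0]|J0 AB0]; last first.
    rewrite -negb_and; apply/negP => /andP [/eqP A'0 /eqP B'0].
    have E : J * A ^+ 2 = 0.
      have -> : J * A ^+ 2 = a 2 * (B ^+ 2 + a 1 * a 3 * A ^+ 2) +
        (a 2 * B ^+ 2 + (a 0 * a 3 ^+ 2 + a 4 * a 1 ^+ 2) * A ^+ 2)
        - (a 2 * B ^+ 2 + a 2 * B ^+ 2) by rewrite /J /a; ring.
      by rewrite A'0 B'0 aa mulr0 subr0 addr0.
    move/eqP: E; rewrite mulf_eq0 J0 /= expf_eq0 /= => /eqP A0.
    move: A'0 AB0; rewrite A0 expr0n mulr0 addr0 eqxx => /eqP.
    by rewrite expf_eq0 /= => ->.
  have -> : (a 2 * A) ^+ 2 + a 1 * a 3 * A ^+ 2 = I * A ^+ 2 by rewrite /I /a; ring.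
  split; last by rewrite mulf_neq0 // ?expf_neq0 //; move: IJ; rewrite J0 eqxx orbF.
  apply/eqP; rewrite -subr_eq0; apply/eqP.
  transitivity (J * A ^+ 2 - (a 1 * a 2 * a 3 + a 1 * a 2 * a 3) * A ^+ 2).
    by rewrite /J /I /a; ring.
  by rewrite aa J0 !mul0r subr0.
have q4 : (4 <= 2 ^ e.+2)%N by rewrite -[4%N]/(2 ^ 2)%N leq_exp2l.
have q2 : (2 <= 2 ^ e.+1)%N by rewrite -{1}[2%N]/(2 ^ 1)%N leq_exp2l.
have qE : (2 ^ e.+2 = 2 * 2 ^ e.+1)%N by rewrite expnS.
(* With q = 2^(e+2) the box consists exactly of the indices q - 3, q - 2, q - 1, so all three
   coefficients would vanish. *)
move=> h; move: h1 h2' h3; rewrite !h; try lia.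
move=> /esym/eqP h1 h2' /esym/eqP h3; move: hAB; rewrite -h2'.
rewrite !mulf_eq0 in h1 h3; case: ifP => [/eqP J0 [/esym/eqP B0 A0]|J0].
  rewrite mulf_eq0 in B0; rewrite (negPf A0) !orbF in h1 B0 h3.
  by move: IJ; rewrite J0 /I (eqP h1) (eqP B0) mul0r expr0n addr0 eqxx.
rewrite eqxx orbF => A0; rewrite (negPf A0) !orbF in h1 h3.
by move: J0; rewrite /J (eqP h1) (eqP h3) !mul0r !expr0n !mulr0 !addr0 eqxx.
Qed.

(** The coefficients of [F ^+ 3] at 5, 6, 7 are a1 I, J + a2 I and a3 I. If I were nonzero, then a1
    = a3 = 0 and the middle one would be a2^3, forcing a2 = 0 and I = 0. *)
Lemma char2_box_vanishing_invariants (k : fieldType) (F : {poly k}) :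
    let a i := F`_i in
    2%N \in [pchar k] -> (size F <= 5)%N -> box_vanishing 12 8 (F ^+ 3) ->
  a 2 ^+ 2 + a 1 * a 3 = 0 /\
  a 0 * a 3 ^+ 2 + a 4 * a 1 ^+ 2 + a 1 * a 2 * a 3 = 0.
Proof.
move=> a h2 sF h.
have aa (x : k) : x + x = 0 by exact: addrr_pchar2.
have := @char2_quartic_step k F 1 0 1 (a 2) h2 sF; rewrite expr1 !mulr1.
move=> /(_ erefl erefl erefl) /=; rewrite -/(a 0) -/(a 1) -/(a 2) -/(a 3) -/(a 4).
rewrite !h // expr1n !mulr1; set I := a 2 ^+ 2 + _ => -[/esym/eqP h1 h2' /esym/eqP h3].
have I0 : I = 0.
  apply/eqP/negPn/negP => I0; move: h1 h3.
  rewrite !mulf_eq0 (negPf I0) !orbF => /eqP a10 /eqP a30.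
  move: h2'; rewrite a10 a30 !expr0n !mulr0 !addr0 -exprS => /esym/eqP.
  rewrite expf_eq0 /= => /eqP a20.
  by move: I0; rewrite /I a20 a10 mul0r expr0n addr0 eqxx.
split=> //.
have -> : a 0 * a 3 ^+ 2 + a 4 * a 1 ^+ 2 + a 1 * a 2 * a 3 =
  (a 2 * a 2 ^+ 2 + (a 0 * a 3 ^+ 2 + a 4 * a 1 ^+ 2)) + a 2 * I
  - (a 2 ^+ 3 + a 2 ^+ 3) by rewrite /I /a; ring.
by rewrite -h2' I0 aa mulr0 subr0 addr0.
Qed.

Lemma char2_invariants_eq0_box_vanishing (k : fieldType) (F : {poly k}) :
    let a i := F`_i in
    2%N \in [pchar k] -> (size F <= 5)%N -> a 2 ^+ 2 + a 1 * a 3 = 0 ->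
    a 0 * a 3 ^+ 2 + a 4 * a 1 ^+ 2 + a 1 * a 2 * a 3 = 0 ->
  box_vanishing 12 8 (F ^+ 3).
Proof.
move=> a h2 sF I0 J0.
have aa (x : k) : x + x = 0 by exact: addrr_pchar2.
have := @char2_quartic_step k F 1 0 1 (a 2) h2 sF; rewrite expr1 !mulr1.
move=> /(_ erefl erefl erefl) /=; rewrite -/(a 0) -/(a 1) -/(a 2) -/(a 3) -/(a 4).
rewrite expr1n !mulr1 I0 !mulr0.
have -> : a 2 * a 2 ^+ 2 + (a 0 * a 3 ^+ 2 + a 4 * a 1 ^+ 2) = 0.
  transitivity (a 2 * (a 2 ^+ 2 + a 1 * a 3)
    + (a 0 * a 3 ^+ 2 + a 4 * a 1 ^+ 2 + a 1 * a 2 * a 3)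
    - (a 1 * a 2 * a 3 + a 1 * a 2 * a 3)); first by rewrite /a; ring.
  by rewrite I0 J0 aa mulr0 subr0 addr0.
move=> [h5 h6 h7] i i1 i2.
have : [|| i == 5%N, i == 6%N | i == 7%N] by lia.
by case/or3P => /eqP ->.
Qed.

Lemma horner_quartic (k : fieldType) (F : {poly k}) (t : k) : (size F <= 5)%N ->
  F.[t] = F`_0 + F`_1 * t + F`_2 * t ^+ 2 + F`_3 * t ^+ 3 + F`_4 * t ^+ 4.
Proof.
move=> sF; rewrite (horner_coef_wide _ sF) !big_ord_recl big_ord0 /= addr0 !addrA.
by rewrite expr0 mulr1 expr1.
Qed.

Lemma horner_quartic_deriv (k : fieldType) (F : {poly k}) (t : k) : (size F <= 5)%N ->
  F^`().[t] = F`_1 + F`_2 * t *+ 2 + F`_3 * t ^+ 2 *+ 3 + F`_4 * t ^+ 3 *+ 4.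
Proof.
move=> sF; have sF' : (size F^`() <= 5)%N.
  apply/leq_sizeP => j hj; rewrite coef_deriv nth_default ?mul0rn //.
  by rewrite ltnW // ltnS (leq_trans sF).
rewrite horner_quartic // !coef_deriv [F`_5]nth_default // mul0rn mul0r addr0.
by rewrite mulr1n !mulrnAl.
Qed.

(** If a3 is nonzero, the double root is the square root t of a1/a3: I = 0 gives a2 = a3 t, and a3^2
    F(t) equals J. If a3 = 0, then a2 = 0 and a4 a1^2 = 0: either the double root is at infinity, or
    F = a4 X^4 + a0 has zero derivative. *)
Lemma char2_double_root (k : closedFieldType) (F : {poly k}) :
    let a i := F`_i in
    2%N \in [pchar k] -> (size F <= 5)%N -> a 2 ^+ 2 + a 1 * a 3 = 0 ->
    a 0 * a 3 ^+ 2 + a 4 * a 1 ^+ 2 + a 1 * a 2 * a 3 = 0 ->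
  (size F <= 3)%N \/ exists2 t, F.[t] = 0 & F^`().[t] = 0.
Proof.
move=> a h2 sF I0 J0.
have aa (x : k) : x + x = 0 by exact: addrr_pchar2.
have [a30|a3] := eqVneq (a 3) 0.
  have a20 : a 2 = 0.
    by move/eqP: I0; rewrite a30 mulr0 addr0 expf_eq0 => /eqP.
  move/eqP: J0; rewrite a30 expr0n !mulr0 addr0 add0r mulf_eq0 expf_eq0 /=.
  have [a40 _|a4 /= /eqP a10] := eqVneq (a 4) 0.
    left; apply/leq_sizeP => j; rewrite leq_eqVlt => /predU1P [<- //|].
    rewrite leq_eqVlt => /predU1P [<- //|] hj.
    by rewrite nth_default // (leq_trans sF).
  right; have [|t /rootP Ft] := closed_rootP F _.
    by apply: contraNN a4 => /eqP s1; rewrite /a nth_default // s1.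
  exists t => //; rewrite horner_quartic_deriv // -/(a 1) -/(a 2) -/(a 3) a10 a20 a30.
  by rewrite !mul0r !mul0rn !add0r (mulrn_pchar_dvdn _ h2).
right; have [|t] := closed_rootP ('X^2 - (a 1 / a 3)%:P) _.
  by rewrite size_XnsubC.
rewrite /root !hornerE subr_eq0 => /eqP Et.
have Ea1 : a 1 = a 3 * t ^+ 2 by rewrite Et mulrC divfK.
have Ea2 : a 2 = a 3 * t.
  apply/eqP; rewrite -subr_eq0 -sqrf_eq0; apply/eqP.
  transitivity (a 2 ^+ 2 + a 1 * a 3 - (a 2 * (a 3 * t) + a 2 * (a 3 * t))).
    by rewrite Ea1 /a; ring.
  by rewrite I0 aa subr0.
exists t.
  rewrite horner_quartic // -/(a 0) -/(a 1) -/(a 2) -/(a 3) -/(a 4) Ea1 Ea2.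
  apply: (mulfI (expf_neq0 2 a3)); rewrite mulr0 -[RHS]J0 Ea1 Ea2.
  apply/eqP; rewrite -subr_eq0; apply/eqP.
  transitivity (a 3 ^+ 3 * t ^+ 3 * (1 + 1)); first by rewrite /a; ring.
  by rewrite aa mulr0.
rewrite horner_quartic_deriv // -/(a 1) -/(a 2) -/(a 3) -/(a 4) Ea1 Ea2.
transitivity ((a 3 * t ^+ 2 *+ 3 + a 4 * t ^+ 3 *+ 2) * (1 + 1)).
  by rewrite /a; ring.
by rewrite aa mulr0.
Qed.

(** * The family x^4 + c x^2 y^2 + y^4 in odd characteristic *)

Lemma coef_exp_XnaddC (k : fieldType) (d : nat) (c : k) (n j : nat) : (0 < d)%N ->
    (j <= n)%N -> (('X^d + c%:P) ^+ n)`_(d * j) = c ^+ (n - j) *+ 'C(n, j).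
Proof.
move=> d0 jn; rewrite exprDn coef_sum.
have hj : (n - j < n.+1)%N by rewrite ltnS leq_subr.
rewrite (bigD1 (Ordinal hj)) //= big1 ?addr0.
  rewrite coefMn subKn // -exprM -polyC_exp coefMC coefXn eqxx mul1r bin_sub //.
move=> i; rewrite -val_eqE /= => ne.
rewrite coefMn -exprM -polyC_exp coefMC coefXn eqn_pmul2l //.
have hi := ltn_ord i.
by case: eqP => [E|_]; [move: ne; rewrite E; lia | rewrite mul0r mul0rn].
Qed.

(** The binomial divides (p - 1)!, which is prime to p by Wilson's theorem. *)
Lemma bin_predp_neq0 (k : fieldType) (p : nat) (hp : p \in [pchar k]) (i : nat) :
  (i <= p.-1)%N -> 'C(p.-1, i)%:R != 0 :> k.
Proof.
move=> ip; have pp := pcharf_prime hp.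
rewrite -(dvdn_pcharf hp); apply/negP => h.
have : (p %| p.-1`!)%N by rewrite -(bin_fact ip) dvdn_mulr.
move/dvdn_addr => /(_ 1%N); rewrite addn1 -Wilson ?prime_gt1 // pp dvdn1.
by move=> /esym/eqP p1; rewrite p1 in pp.
Qed.

(* The coefficient of X^(2m) in (X^4 + c X^2 + 1)^m is a polynomial of degree m
   in c, essentially a Legendre polynomial. *)
Lemma legendre_exists (k : fieldType) (m : nat) :
  exists2 L : {poly k}, size L = m.+1
    & forall c, L.[c] = (('X^4 + c *: 'X^2 + 1) ^+ m)`_m.*2.
Proof.
(* Expanding ((X^4 + 1) + c X^2)^m, the power c^i meets the coefficient of X^(2(m - i)) in (X^4 +
   1)^(m - i). The top coefficient [l m] is 1. *)
pose l i : k := (('X^4 + 1 : {poly k}) ^+ (m - i))`_(m - i).*2 *+ 'C(m, i).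
exists (\poly_(i < m.+1) l i).
  by rewrite size_poly_eq // /l subnn expr0 coefC eqxx binn oner_neq0.
move=> c; rewrite horner_poly addrAC exprDn coef_sum; apply: eq_bigr => i _.
have hi : (i <= m)%N by rewrite -ltnS.
rewrite coefMn exprZn -scalerAr coefZ -exprM coefMXn.
rewrite ltnNge -mul2n leq_mul2l hi orbT /= -mulnBr mul2n /l.
by rewrite mulrnAl mulrC.
Qed.

(** A common root t is nonzero, so F'(t) = 2t(2t^2 + c) gives 2t^2 + c = 0; then c^2 - 4 = (c +
    2t^2)^2 - 4F(t) vanishes. *)
Lemma quartic_family_coprime (k : closedFieldType) (c : k) :
    2%:R != 0 :> k -> c ^+ 2 != 4%:R ->
  coprimep ('X^4 + c *: 'X^2 + 1) ('X^4 + c *: 'X^2 + 1)^`().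
Proof.
move=> n2 c2; apply/Pdiv.ClosedField.coprimepP => t; rewrite /root.
have -> : ('X^4 + c *: 'X^2 + 1).[t] = t ^+ 4 + c * t ^+ 2 + 1 by rewrite !hornerE.
have -> : ('X^4 + c *: 'X^2 + 1)^`().[t] = t ^+ 3 *+ 4 + c * (t *+ 2).
  rewrite !derivD derivXn derivZ derivXn derivC addr0 hornerD hornerMn hornerXn.
  by rewrite hornerZ hornerMn expr1 hornerX.
move=> /eqP F0; apply/eqP => dF0.
have t0 : t != 0.
  by apply: contra_eq_neq F0 => ->; rewrite !expr0n /= mulr0 !add0r oner_eq0.
have E : c + 2%:R * t ^+ 2 = 0.
  apply: (mulfI (mulf_neq0 n2 t0)); rewrite mulr0 -[RHS]dF0; ring.
case/eqP: c2; rewrite -[RHS]subr0 -[4%:R - 0]addr0; apply/eqP; rewrite -subr_eq0.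
have -> : c ^+ 2 - (4%:R - 0 + 0) =
  (c + 2%:R * t ^+ 2) ^+ 2 - 4%:R * (t ^+ 4 + c * t ^+ 2 + 1) by ring.
by rewrite E F0 expr0n mulr0 subr0.
Qed.

Lemma quartic_family_size (k : fieldType) (c : k) :
  size ('X^4 + c *: 'X^2 + 1 : {poly k}) = 5%N.
Proof.
rewrite -addrA size_polyDl ?size_polyXn //.
rewrite (leq_ltn_trans (size_polyD _ _)) // gtn_max size_poly1 andbT.
by rewrite (leq_ltn_trans (size_scale_leq _ _)) // size_polyXn.
Qed.

(** For c = 2 or c = -2 the quartic is (X^2 + c/2)^2, and the coefficient is (c/2)^m times the
    binomial of p - 1 over m. Thus zeros of the Legendre polynomial avoid the non-reduced
    members. *)
Lemma legendre_neq0 (k : fieldType) (p m : nat) (hp : p \in [pchar k]) (c : k) :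
    p = m.*2.+1 -> c ^+ 2 = 4%:R ->
  (('X^4 + c *: 'X^2 + 1 : {poly k}) ^+ m)`_m.*2 != 0.
Proof.
move=> pE c4.
have n2 : 2%:R != 0 :> k.
  rewrite -(dvdn_pcharf hp); apply/negP => /dvdn_leq => /(_ isT).
  have := prime_gt1 (pcharf_prime hp); rewrite pE; lia.
have -> : 'X^4 + c *: 'X^2 + 1 = ('X^2 + (c / 2%:R)%:P) ^+ 2 :> {poly k}.
  have h : (c / 2%:R) ^+ 2 = 1.
    by rewrite expr_div_n c4 (natrM _ 2 2) -expr2 divff // expf_neq0.
  rewrite sqrrD -!exprM -polyC_exp h -mulrnAr -polyCMn -[_ / _ *+ 2]mulr_natr divfK //.
  by rewrite mulrC mul_polyC.
have bm : (m <= p.-1)%N by rewrite pE; lia.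
rewrite -exprM -mul2n coef_exp_XnaddC //; last by lia.
rewrite -mulr_natr mulf_neq0 //; last by have := bin_predp_neq0 hp bm; rewrite pE mul2n.
rewrite expf_neq0 // mulf_neq0 ?invr_neq0 //.
by apply: contraNneq n2 => c0; rewrite -sqrf_eq0 expr2 -natrM -c4 c0 expr0n.
Qed.

(** The parameter c is a root of the Legendre polynomial, whose degree m is positive. *)
Lemma supersingular_quartic_exists (k : closedFieldType) (p m : nat)
    (hp : p \in [pchar k]) : p = m.*2.+1 ->
  exists F : {poly k}, [/\ size F = 5%N, coprimep F F^`() & (F ^+ m)`_m.*2 = 0].
Proof.
move=> pE.
have n2 : 2%:R != 0 :> k.
  rewrite -(dvdn_pcharf hp); apply/negP => /dvdn_leq => /(_ isT).
  have := prime_gt1 (pcharf_prime hp); rewrite pE; lia.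
have m0 : (0 < m)%N by have := prime_gt1 (pcharf_prime hp); rewrite pE; lia.
have [L sL EL] := legendre_exists k m.
have [|c] := closed_rootP L _; first by rewrite sL eqSS -lt0n.
rewrite /root EL => /eqP c0.
exists ('X^4 + c *: 'X^2 + 1); rewrite quartic_family_size; split=> //.
apply: quartic_family_coprime => //; apply/negP => /eqP c4.
by have := legendre_neq0 hp pE c4; rewrite c0 eqxx.
Qed.

(** The parameter c avoids the finitely many zeros of the Legendre polynomial and of c^2 - 4. *)
Lemma ordinary_quartic_exists (k : closedFieldType) (p m : nat)
    (hp : p \in [pchar k]) : p = m.*2.+1 ->
  exists F : {poly k}, [/\ size F = 5%N, coprimep F F^`() & (F ^+ m)`_m.*2 != 0].
Proof.
move=> pE.
have n2 : 2%:R != 0 :> k.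
  rewrite -(dvdn_pcharf hp); apply/negP => /dvdn_leq => /(_ isT).
  have := prime_gt1 (pcharf_prime hp); rewrite pE; lia.
have [L sL EL] := legendre_exists k m.
have /closed_nonrootP [c] : L * ('X^2 - 4%:R%:P) != 0.
  by rewrite mulf_neq0 // -size_poly_gt0 ?size_XnsubC // sL.
rewrite /root !hornerE mulf_eq0 negb_or subr_eq0 => /andP [Lc c4].
exists ('X^4 + c *: 'X^2 + 1); rewrite quartic_family_size; split=> //.
  exact: quartic_family_coprime.
by rewrite -EL.
Qed.

(** * Binary forms and their dehomogenizations *)

Lemma mdeg2 (m : 'X_{1..2}) : mdeg m = (m 0%R + m 1%R)%N.
Proof.
rewrite mdegE !big_ord_recl big_ord0 addn0; congr (m _ + m _)%N; exact: val_inj.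
Qed.

Lemma mnm2P (m m' : 'X_{1..2}) : mdeg m = mdeg m' -> m 0%R = m' 0%R -> m = m'.
Proof.
rewrite !mdeg2 => E E0; apply/mnmP => i.
have [->|->] : i = 0%R \/ i = 1%R; [|by []|by lia].
by case: i => [[|[|//]] hi]; [left|right]; apply: val_inj.
Qed.

Definition mnm2 (a b : nat) : 'X_{1..2} := (U_(0%R) *+ a + U_(1%R) *+ b)%MM.

Lemma mnm2E (a b : nat) : (mnm2 a b 0%R = a) * (mnm2 a b 1%R = b).
Proof.
by split; rewrite /mnm2 mnmDE !mulmnE !mnm1E /= ?muln0 ?mul0n ?mul1n ?addn0.
Qed.

Lemma mdeg_mnm2 (a b : nat) : mdeg (mnm2 a b) = (a + b)%N.
Proof. by rewrite mdeg2 !mnm2E. Qed.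

Section Dehomogenization.
Variable k : fieldType.

Definition dehom_var (i : 'I_2) : {poly k} := if i == 0%R then 'X else 1.
Definition dehom : {mpoly k[2]} -> {poly k} := mmap polyC dehom_var.

HB.instance Definition _ := GRing.RMorphism.copy dehom (mmap polyC dehom_var).

(** Terms of degree above d are dropped; on polynomials of size at most d + 1 this is a section of
    [dehom]. *)
Definition homogenize (d : nat) (F : {poly k}) : {mpoly k[2]} :=
  \sum_(i < d.+1) F`_i *: 'X_[mnm2 i (d - i)].

Lemma dehomX (m : 'X_{1..2}) : dehom 'X_[m] = 'X^(m 0%R).
Proof.
rewrite /dehom mmapX /mmap1 !big_ord_recl big_ord0 mulr1 /dehom_var /=.
by rewrite expr1n mulr1.
Qed.

Lemma dehomZ (c : k) (f : {mpoly k[2]}) : dehom (c *: f) = c *: dehom f.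
Proof. by rewrite /dehom mmapZ mul_polyC. Qed.

Lemma dehomE (f : {mpoly k[2]}) : dehom f = \sum_(m <- msupp f) f@_m *: 'X^(m 0%R).
Proof.
by rewrite {1}[f]mpolyE rmorph_sum; apply: eq_bigr => m _ /=; rewrite dehomZ dehomX.
Qed.

Lemma size_dehom (f : {mpoly k[2]}) : (size (dehom f) <= msize f)%N.
Proof.
rewrite dehomE; apply: (leq_trans (size_sum _ _ _)); apply/bigmax_leqP_seq => m hm _.
apply: (leq_trans (size_scale_leq _ _)); rewrite size_polyXn.
by apply: leq_trans (msize_mdeg_lt hm); rewrite ltnS mdeg2 leq_addr.
Qed.

(** Within one degree the exponent of x determines the monomial, so no two terms of [f] merge. *)
Lemma coef_dehom (d : nat) (f : {mpoly k[2]}) (m : 'X_{1..2}) :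
  f \is d.-homog -> mdeg m = d -> (dehom f)`_(m 0%R) = f@_m.
Proof.
move=> hf hm; rewrite dehomE coef_sum.
have [hs|hs] := boolP (m \in msupp f).
  rewrite (bigD1_seq m) //= coefZ coefXn eqxx mulr1 big1_seq ?addr0 //.
  move=> m' /andP [ne hm']; rewrite coefZ coefXn.
  case: eqP => [E|]; last by rewrite mulr0.
  by case/eqP: ne; apply: mnm2P => //; rewrite hm (dhomog_mf hf hm').
rewrite big1_seq; first by rewrite (memN_msupp_eq0 hs).
move=> m' /= hm'; rewrite coefZ coefXn; case: eqP => [E|]; last by rewrite mulr0.
by rewrite (@mnm2P m m') ?hm' // in hs; rewrite hm (dhomog_mf hf hm').
Qed.

Lemma size_dehom_homog (d : nat) (f : {mpoly k[2]}) :
  f \is d.-homog -> (size (dehom f) <= d.+1)%N.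
Proof.
move=> hf; apply: leq_trans (size_dehom f) _.
by rewrite msizeE; apply/bigmax_leqP_seq => m hm _; rewrite (dhomog_mf hf hm).
Qed.

Lemma dehom_inj (d : nat) (f g : {mpoly k[2]}) :
  f \is d.-homog -> g \is d.-homog -> dehom f = dehom g -> f = g.
Proof.
move=> hf hg E; apply/mpolyP => m; have [hm|hm] := eqVneq (mdeg m) d.
  by rewrite -(coef_dehom hf hm) E (coef_dehom hg hm).
by rewrite (dhomog_nemf_coeff hf hm) (dhomog_nemf_coeff hg hm).
Qed.

Lemma homogenize_homog (d : nat) (F : {poly k}) : homogenize d F \is d.-homog.
Proof.
apply: rpred_sum => i _; apply: rpredZ; rewrite dhomogX /= mdeg_mnm2.
by rewrite subnKC // -ltnS.
Qed.

Lemma homogenizeK (d : nat) (F : {poly k}) :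
  (size F <= d.+1)%N -> dehom (homogenize d F) = F.
Proof.
move=> sF; rewrite rmorph_sum /=; apply/polyP => i; rewrite coef_sum.
under eq_bigr => j _ do rewrite dehomZ dehomX mnm2E coefZ coefXn.
have [hi|hi] := ltnP i d.+1.
  rewrite (bigD1 (Ordinal hi)) //= eqxx mulr1 big1 ?addr0 // => j ne.
  by rewrite eq_sym -[_ == _]/(j == Ordinal hi) (negPf ne) mulr0.
rewrite big1 ?nth_default // ?(leq_trans sF) // => j _.
by rewrite gtn_eqF ?mulr0 // (leq_trans _ hi).
Qed.

Lemma dehomK (d : nat) (f : {mpoly k[2]}) :
  f \is d.-homog -> homogenize d (dehom f) = f.
Proof.
move=> hf; apply: (dehom_inj (homogenize_homog _ _) hf).
by rewrite homogenizeK // size_dehom_homog.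
Qed.

Lemma homogenizeM (d e : nat) (F G : {poly k}) :
  (size F <= d.+1)%N -> (size G <= e.+1)%N ->
  homogenize (d + e) (F * G) = homogenize d F * homogenize e G.
Proof.
move=> sF sG; apply: (@dehom_inj (d + e)).
- exact: homogenize_homog.
- by apply: dhomogM; exact: homogenize_homog.
rewrite rmorphM /= !homogenizeK //.
by apply: leq_trans (size_polyMleq _ _) _; lia.
Qed.

Lemma dehom_eq0 (d : nat) (f : {mpoly k[2]}) :
  f \is d.-homog -> (dehom f == 0) = (f == 0).
Proof.
move=> hf; apply/eqP/eqP => [E|->]; last by rewrite rmorph0.
by apply: (dehom_inj hf (dhomog0 _ _ _)); rewrite E rmorph0.
Qed.

Lemma form_coeffE (d : nat) (f : {mpoly k[2]}) (i : 'I_d.+1) :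
  f \is d.-homog -> form_coeff f i = (dehom f)`_i.
Proof.
move=> hf; rewrite /form_coeff -/(mnm2 i (d - i)) -(coef_dehom hf) ?mnm2E //.
by rewrite mdeg_mnm2 subnKC // -ltnS.
Qed.

(** The ideal is monomial, so membership is tested term by term: terms divisible by x^q go into one
    summand, and the remaining ones are divisible by y^q. *)
Lemma in_xy_powP (q : nat) (f : {mpoly k[2]}) :
  in_xy_pow q f <-> forall m : 'X_{1..2}, (m 0%R < q)%N -> (m 1%R < q)%N -> f@_m = 0.
Proof.
split=> [[g [h ->]] m m0 m1|H].
  have zero (i : 'I_2) (g' : {mpoly k[2]}) : (m i < q)%N -> (g' * 'X_i ^+ q)@_m = 0.
    move=> mi; rewrite mpolyXn; apply/memN_msupp_eq0.
    rewrite (perm_mem (msuppMX _ _)); apply/mapP => [[m' _ E]].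
    move: mi; rewrite E mnmDE mulmnE mnm1E eqxx mul1n; lia.
  by rewrite mcoeffD !zero // addr0.
rewrite [f]mpolyE.
pose S := [pred m : 'X_{1..2} | (q <= m 0%R)%N].
exists (\sum_(m <- msupp f | S m) f@_m *: 'X_[m - U_(0%R) *+ q]).
exists (\sum_(m <- msupp f | ~~ S m) f@_m *: 'X_[m - U_(1%R) *+ q]).
rewrite !mulr_suml (bigID S) /=; congr (_ + _).
  apply: eq_bigr => m hm; rewrite -scalerAl mpolyXn -mpolyXD submK //.
  apply/mnm_lepP => i; rewrite mulmnE mnm1E; case: eqP => [<-|_]; last by rewrite mul0n.
  by rewrite mul1n.
rewrite big_seq_cond [RHS]big_seq_cond.
apply: eq_bigr => m /andP [hs hm]; rewrite -scalerAl mpolyXn -mpolyXD submK //.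
apply/mnm_lepP => i; rewrite mulmnE mnm1E; case: eqP => [<-|_]; last by rewrite mul0n.
rewrite mul1n leqNgt; apply/negP => hm1; rewrite -ltnNge in hm.
by move: hs; rewrite mcoeff_msupp H // eqxx.
Qed.

Lemma in_xy_pow_box (d q : nat) (f : {mpoly k[2]}) :
  f \is d.-homog -> in_xy_pow q f <-> box_vanishing d q (dehom f).
Proof.
move=> hf; split=> [/in_xy_powP H a a1 a2|H].
  have [ad|ad] := leqP a d; last first.
    by rewrite nth_default // (leq_trans (size_dehom_homog hf)).
  have E := @coef_dehom d f (mnm2 a (d - a)) hf.
  rewrite mnm2E mdeg_mnm2 subnKC // in E; rewrite E // H ?mnm2E //; lia.
apply/in_xy_powP => m m0 m1; have [hm|hm] := eqVneq (mdeg m) d.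
  by rewrite -(coef_dehom hf hm) H // -hm mdeg2; lia.
exact: (dhomog_nemf_coeff hf hm).
Qed.

(** Total degree is additive on products, so one factor of a linear form is a nonzero constant. *)
Lemma linear_irreducible (l : {mpoly k[2]}) :
  l != 0 -> l \is 1.-homog -> irreducible_mpoly l.
Proof.
move=> l0 hl.
have sl : msize l = 2%N.
  have := dhomog_uniq l0 hl (dhomog_msize hl).
  by case: (msize l) => [//|[//|n]] /= [<-].
have unit1 (a : {mpoly k[2]}) : msize a = 1%N -> a \is a GRing.unit.
  move/eqP/msize_poly1P => [c c0 ->].
  by apply/unitrP; exists (c^-1)%:MP; rewrite -!mpolyCM mulVf // mulfV.
split=> // [|a b E].
  apply/negP => /unitrP [h [h1 _]].
  have h0 : h != 0 by apply: contra_eq_neq h1 => ->; rewrite mul0r eq_sym oner_eq0.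
  have := msizeM h0 l0; rewrite h1 msize1 sl.
  by move: h0; rewrite -msize_poly_eq0; case: (msize h) => [//|n] _; rewrite addn2.
have /andP [a0 b0] : (a != 0) && (b != 0) by rewrite -negb_or -mulf_eq0 -E.
have := msizeM a0 b0; rewrite -E sl.
move: a0 b0 (unit1 a) (unit1 b); rewrite -!msize_poly_eq0.
case: (msize a) => [//|[|s]] _; case: (msize b) => [//|[|t]] _ ua ub; auto.
by rewrite !addSn !addnS.
Qed.

(** A constant [l] is allowed: it homogenizes to a multiple of y, which covers a double root at
    infinity. *)
Lemma reduced_no_linear_square (d : nat) (l h : {poly k}) (f : {mpoly k[2]}) :
    f \is d.+2.-homog -> dehom f = l ^+ 2 * h -> l != 0 -> (size l <= 2)%N ->
  (size h <= d.+1)%N -> ~ reduced f.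
Proof.
move=> hf E l0 sl sh [_ /(_ (homogenize 1 l))]; case.
  apply: linear_irreducible; last exact: homogenize_homog.
  by rewrite -(dehom_eq0 (homogenize_homog _ _)) homogenizeK.
exists (homogenize d h); rewrite -(dehomK hf) E !expr2 -(homogenizeM sl sl).
rewrite -homogenizeM ?add2n // (leq_trans (size_polyMleq _ _)) //; lia.
Qed.

End Dehomogenization.

(** If g^2 divides [f], then [dehom g] divides F and F', hence is constant. As F has full degree d,
    dehomogenization loses no degree, so g itself is constant; this rules out g = y. *)
Lemma reduced_of_coprime_deriv (k : fieldType) (d : nat) (f : {mpoly k[2]}) :
    f \is d.-homog -> size (dehom f) = d.+1 -> coprimep (dehom f) (dehom f)^`() ->
  reduced f.
Proof.
move=> hf sF cF; have F0 : dehom f != 0 by rewrite -size_poly_gt0 sF.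
split; first by rewrite -(dehom_eq0 hf).
move=> g [_ gU _] [h E].
have sf : (msize f <= d.+1)%N.
  by rewrite msizeE; apply/bigmax_leqP_seq => m hm _; rewrite (dhomog_mf hf hm).
have EF : dehom f = dehom g * (dehom g * dehom h).
  by rewrite E expr2 !rmorphM /= mulrA.
have sG : size (dehom g) = 1%N.
  move/coprimepP: cF => /(_ (dehom g)) cF.
  apply/eqP; rewrite size_poly_eq1 cF // EF ?dvdp_mulIl // derivM dvdp_add //.
    by rewrite mulrC -mulrA dvdp_mulIl.
  by rewrite dvdp_mulIl.
have [G0 H0] : dehom g != 0 /\ dehom h != 0.
  by move: F0; rewrite EF !mulf_eq0 !negb_or => /and3P [].
have [g0 h0] : g != 0 /\ h != 0.
  by split; [move: G0|move: H0]; apply: contra_neq => ->; rewrite rmorph0.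
have gg0 : g * g != 0 by rewrite mulf_neq0.
move: sf; rewrite E expr2 !msizeM // -sF EF !size_mul ?mulf_neq0 // sG.
have := size_dehom g; have := size_dehom h; rewrite sG.
have : msize g != 1%N.
  apply: contraNneq gU => /eqP/msize_poly1P [c c0 ->].
  by apply/unitrP; exists (c^-1)%:MP; rewrite -!mpolyCM mulVf // mulfV.
move: (size_poly_gt0 (dehom h)); rewrite H0.
move: (msize g) (msize h) (size (dehom h)) => a b c; lia.
Qed.

(** * Bounds on the F-pure threshold *)

Section FPureThreshold.
Variables (R : realType) (k : fieldType) (p : nat).
Hypothesis hp : p \in [pchar k].

Lemma in_xy_powMr (q : nat) (f g : {mpoly k[2]}) :
  in_xy_pow q f -> in_xy_pow q (f * g).
Proof.
move=> [u [v ->]]; exists (u * g), (v * g).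
by rewrite mulrDl -!mulrA ![_ * g]mulrC.
Qed.

Lemma in_xy_pow_frobenius (d q e : nat) (f : {mpoly k[2]}) : f \is d.-homog ->
  in_xy_pow q f <-> in_xy_pow (p ^ e * q) (f ^+ (p ^ e)).
Proof.
move=> hf; elim: e => [|e IHe]; first by rewrite expn0 mul1n expr1.
have hfe : f ^+ (p ^ e) \is (d * p ^ e).-homog by exact: dhomogMn.
have hfe' : f ^+ (p ^ e.+1) \is (p * (d * p ^ e)).-homog.
  by rewrite mulnCA -expnS; exact: dhomogMn.
apply: (iff_trans IHe); apply: (iff_trans (in_xy_pow_box _ hfe)).
apply: iff_sym; apply: (iff_trans (in_xy_pow_box _ hfe')).
rewrite expnS -mulnA [(p * p ^ e)%N]mulnC exprM rmorphXn /=; apply: iff_sym.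
exact: box_vanishing_frobenius.
Qed.

Lemma p_expn_gt0 (e : nat) : (0 < p ^ e)%N.
Proof. by rewrite expn_gt0 (prime_gt0 (pcharf_prime hp)). Qed.

(** Over a common denominator: if N'/p^e' exceeded N/p^e, then f^(N' p^e) would be a multiple of
    f^(N p^e'), hence in the ideal at level p^(e + e'), and Frobenius would put f^N' into the ideal
    at level p^e'. *)
Lemma in_xy_pow_bound (d N e N' e' : nat) (f : {mpoly k[2]}) : f \is d.-homog ->
    in_xy_pow (p ^ e) (f ^+ N) -> ~ in_xy_pow (p ^ e') (f ^+ N') ->
  N'%:R / (p ^ e')%:R <= N%:R / (p ^ e)%:R :> R.
Proof.
move=> hf h h'; rewrite ler_pdivrMr ?ltr0n ?p_expn_gt0 // mulrAC.
rewrite ler_pdivlMr ?ltr0n ?p_expn_gt0 // -!natrM ler_nat leqNgt; apply/negP => lt.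
apply: h'; apply/(in_xy_pow_frobenius _ e (dhomogMn N' hf)); rewrite -exprM.
have -> : (N' * p ^ e = N * p ^ e' + (N' * p ^ e - N * p ^ e'))%N.
  by rewrite subnKC // ltnW.
rewrite exprD mulnC; apply: in_xy_powMr; rewrite exprM.
exact/(in_xy_pow_frobenius _ e' (dhomogMn N hf)).
Qed.

Lemma one_notin_xy_pow (q : nat) : (0 < q)%N -> ~ in_xy_pow q (1 : {mpoly k[2]}).
Proof.
move=> q0 /in_xy_powP /(_ 0%MM); rewrite !mnm0E => /(_ q0 q0) /eqP.
by rewrite mcoeff1 eqxx oner_eq0.
Qed.

Lemma fpt_le_ub (f : {mpoly k[2]}) (c : R) :
    (forall N e, ~ in_xy_pow (p ^ e) (f ^+ N) -> N%:R / (p ^ e)%:R <= c) ->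
  fpt R p f <= c.
Proof.
move=> H; apply: ge_sup; last by move=> _ [N [e [h ->]]]; exact: H.
(* The least upper bound property requires a nonempty set; N = e = 0 provides an element. *)
exists (0%:R / (p ^ 0)%:R), 0%N, 0%N; split=> //.
by rewrite expr0; exact: one_notin_xy_pow.
Qed.

Lemma fpt_le (d N e : nat) (f : {mpoly k[2]}) : f \is d.-homog ->
  in_xy_pow (p ^ e) (f ^+ N) -> fpt R p f <= N%:R / (p ^ e)%:R.
Proof.
by move=> hf h; apply: fpt_le_ub => N' e' h'; exact: in_xy_pow_bound hf h h'.
Qed.

Lemma fpt_ge (d N e : nat) (f : {mpoly k[2]}) : f \is d.+1.-homog ->
  ~ in_xy_pow (p ^ e) (f ^+ N) -> N%:R / (p ^ e)%:R <= fpt R p f.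
Proof.
move=> hf h; apply: ub_le_sup; last by exists N, e.
(* A form of positive degree lies in (x, y), so 1 bounds the set from above. *)
exists (1%:R / (p ^ 0)%:R) => _ [N' [e' [h' ->]]]; apply: (in_xy_pow_bound hf _ h').
rewrite expr1; apply/(in_xy_pow_box _ hf) => a; rewrite expn0 ltnS leqn0 => /eqP ->.
by rewrite addn0 ltnS ltn0.
Qed.

(** At level q the hypothesis yields fpt f >= N/q >= c - 1/q, and 1/q tends to 0. *)
Lemma fpt_ge_lim (d : nat) (c : R) (f : {mpoly k[2]}) : f \is d.+1.-homog ->
    (forall e, exists2 N, ~ in_xy_pow (p ^ e.+1) (f ^+ N)
                        & c * (p ^ e.+1)%:R <= N.+1%:R) ->
  c <= fpt R p f.
Proof.
move=> hf H; apply/ler_addgt0Pr => eps eps0.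
have [n hn] : exists n : nat, eps^-1 < n%:R.
  by exists (Num.truncn eps^-1).+1; exact: truncnS_gt.
have [N h1 h2] := H n.
have q0 : 0 < (p ^ n.+1)%:R :> R by rewrite ltr0n p_expn_gt0.
have nq : n%:R <= (p ^ n.+1)%:R :> R.
  rewrite ler_nat ltnW // (ltn_trans (ltn_expl n (prime_gt1 (pcharf_prime hp)))) //.
  by rewrite ltn_exp2l // prime_gt1 // (pcharf_prime hp).
have h3 := fpt_ge hf h1.
have : c <= N.+1%:R / (p ^ n.+1)%:R by rewrite ler_pdivlMr.
rewrite -addn1 natrD mulrDl mul1r => /le_trans; apply; apply: lerD => //.
by rewrite invf_ple ?posrE // (le_trans (ltW hn)).
Qed.

Lemma fpt_quartic_le_half (f : {mpoly k[2]}) : f \is 4.-homog -> fpt R p f <= 1 / 2.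
Proof.
move=> hf; apply: fpt_le_ub => N e h.
rewrite ler_pdivrMr ?ltr0n ?p_expn_gt0 // mulrAC mul1r ler_pdivlMr ?ltr0n //.
rewrite -natrM ler_nat leqNgt; apply/negP => lt; apply: h.
apply/(in_xy_pow_box _ (dhomogMn N hf)) => a a1 a2; lia.
Qed.

End FPureThreshold.

(** * Openness and density *)

(** Coefficients of the N-th power of the generic form [G] are homogeneous of degree N in its
    coefficients; those with index in the box define the complement. *)
Lemma zariski_open_not_in_xy_pow (k : fieldType) (d N q : nat) :
  zariski_open d [set f : {mpoly k[2]} | nonzero_form d f /\ ~ in_xy_pow q (f ^+ N)].
Proof.
pose G : {poly {mpoly k[d.+1]}} := \poly_(i < d.+1) 'X_(inord i).
have hG n a : (G ^+ n)`_a \is n.-homog.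
  elim: n a => [|n IHn] a.
    by rewrite expr0 coefC; case: ifP; rewrite ?dhomog1 ?dhomog0.
  rewrite exprS coefM; apply: rpred_sum => i _; rewrite -(add1n n).
  apply: dhomogM => //.
  rewrite coef_poly; case: ifP => _; last exact: dhomog0.
  by rewrite dhomogX /= mdeg1.
have evG (f : {mpoly k[2]}) a : f \is d.-homog ->
    ((G ^+ N)`_a).@[@form_coeff k d f] = (dehom (f ^+ N))`_a.
  move=> hf; rewrite -coef_map rmorphXn rmorphXn /=; congr (nth 0 (polyseq (_ ^+ _)) _).
  apply/polyP => i; rewrite coef_map coef_poly; case: ltnP => hi.
    by rewrite /= mevalXU form_coeffE // inordK.
  by rewrite /= meval0 nth_default // (leq_trans (size_dehom_homog hf)).
exists [set P | exists a, [/\ (a < q)%N, (d * N < q + a)%N & P = (G ^+ N)`_a]].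
split=> [P [a [_ _ ->]]|f]; first by exists N.
split=> [[[f0 hf] h]|[[f0 hf] [_ [a [a1 a2 ->]] ne]]]; split=> //.
  apply: contrapT => no; apply: h; apply/(in_xy_pow_box _ (dhomogMn N hf)) => a a1 a2.
  apply/eqP/negPn/negP => ne; apply: no; exists (G ^+ N)`_a; first by exists a.
  by rewrite evG.
by move: ne; rewrite evG // => /eqP ne /(in_xy_pow_box _ (dhomogMn N hf)) /(_ a a1 a2).
Qed.

Lemma form_coeff_neq0 (k : fieldType) (d : nat) (f : {mpoly k[2]}) :
  nonzero_form d f -> exists i : 'I_d.+1, form_coeff f i != 0.
Proof.
move=> [f0 hf]; have F0 : dehom f != 0 by rewrite (dehom_eq0 hf).
have hi : ((size (dehom f)).-1 < d.+1)%N.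
  by rewrite prednK ?size_poly_gt0 // size_dehom_homog.
by exists (Ordinal hi); rewrite form_coeffE //= -lead_coefE lead_coef_eq0.
Qed.

(** Irreducibility of projective space: two nonempty open sets meet on the line joining a point of
    each, since k is infinite. *)
Lemma zariski_open_dense (k : closedFieldType) (d : nat) (U : set {mpoly k[2]}) :
  zariski_open d U -> (exists f, U f) -> zariski_dense d U.
Proof.
move=> [S [_ hU]] [f1 /hU [f1P [Q SQ Q1]]] V [T [_ hV]] [f0 /hV [f0P [P TP P0]]].
have [i0 hi0] := form_coeff_neq0 f1P.
(* Neither P nor Q vanishes identically on the line through f0 and f1. *)
pose l (i : 'I_d.+1) : {poly k} :=
  (form_coeff f0 i)%:P + (form_coeff f1 i - form_coeff f0 i) *: 'X.
have l0 i : (l i).[0] = form_coeff f0 i by rewrite /l !hornerE.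
have l1 i : (l i).[1] = form_coeff f1 i.
  by rewrite /l hornerD hornerC hornerZ hornerX mulr1 addrC subrK.
pose ev (W : {mpoly k[d.+1]}) : {poly k} := mmap polyC l W.
have evE W t : (ev W).[t] = W.@[fun i => (l i).[t]].
  rewrite /ev /mmap mevalE horner_sum; apply: eq_bigr => m _.
  rewrite hornerM hornerC horner_prod; congr (_ * _).
  by apply: eq_bigr => i _; rewrite horner_exp.
(* The factor [l i0] ensures that the form at the chosen parameter is nonzero. *)
have nz : ev P * ev Q * l i0 != 0.
  rewrite !mulf_neq0 //; apply/eqP.
  - move=> /(congr1 (horner^~ 0)); rewrite evE horner0 => /eqP.
    by apply/negP; rewrite (meval_eq _ l0).
  - move=> /(congr1 (horner^~ 1)); rewrite evE horner0 => /eqP.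
    by apply/negP; rewrite (meval_eq _ l1).
  - by move=> /(congr1 (horner^~ 1)); rewrite l1 horner0 => /eqP; exact/negP.
have /closed_nonrootP [t] := nz; rewrite /root !hornerM !mulf_eq0 !negb_or !evE.
move=> /andP [/andP [Pt Qt] it].
pose f := homogenize d (\poly_(i < d.+1) (l (inord i)).[t]).
have hf : f \is d.-homog by exact: homogenize_homog.
have fE i : form_coeff f i = (l i).[t].
  by rewrite form_coeffE // homogenizeK ?size_poly // coef_poly ltn_ord inord_val.
have f0' : nonzero_form d f.
  split=> //; apply: contraNneq it => E; rewrite -fE E form_coeffE ?dhomog0 //.
  by rewrite rmorph0 coef0.
exists f; split; [apply/hV|apply/hU]; split=> //; [exists P|exists Q] => //;
  by rewrite (meval_eq _ fE).
Qed.

(** * Thresholds of quartic forms *)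

Section Quartics.
Variables (R : realType) (k : closedFieldType) (p : nat).
Hypothesis hp : p \in [pchar k].

Lemma quartic_double_root_not_reduced (f : {mpoly k[2]}) (t : k) :
    f \is 4.-homog -> (dehom f).[t] = 0 -> (dehom f)^`().[t] = 0 -> ~ reduced f.
Proof.
move=> hf /rootP/factor_theorem [G EG].
rewrite EG derivM derivXsubC mulr1 hornerD hornerM hornerXsubC subrr mulr0 add0r.
move=> /rootP/factor_theorem [H EH].
have EF : dehom f = ('X - t%:P) ^+ 2 * H by rewrite EG EH; ring.
have [H0|H0] := eqVneq H 0.
  by move=> [f0 _]; move: f0; rewrite -(dehom_eq0 hf) EF H0 mulr0 eqxx.
apply: (reduced_no_linear_square hf EF); rewrite ?polyXsubC_eq0 ?size_XsubC //.
have := size_dehom_homog hf; rewrite EF size_mul ?expf_neq0 ?polyXsubC_eq0 //.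
by rewrite size_exp_XsubC; move: (size H) => s; lia.
Qed.

(* Here y^2 divides f: the double root is at infinity. *)
Lemma quartic_size3_not_reduced (f : {mpoly k[2]}) :
    f \is 4.-homog -> (size (dehom f) <= 3)%N -> ~ reduced f.
Proof.
move=> hf sF; apply: (@reduced_no_linear_square _ 2 1 (dehom f) f) => //.
- by rewrite expr1n mul1r.
- exact: oner_neq0.
- by rewrite size_poly1.
Qed.

Lemma fpt_quartic_char2 (f : {mpoly k[2]}) : p = 2%N -> f \is 4.-homog ->
  ~ in_xy_pow (p ^ 3) (f ^+ 3) -> fpt R p f = 1 / 2.
Proof.
move=> p2 hf h; have h2 : 2%N \in [pchar k] by rewrite -p2.
apply/le_anti; rewrite fpt_quartic_le_half //=.
(* At level 2^(e+1), N = 2^e - 1 makes N + 1 exactly half of the level. *)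
apply: (fpt_ge_lim hp hf) => e; exists (p ^ e).-1.
  move/(in_xy_pow_box _ (dhomogMn _ hf)); rewrite rmorphXn p2 /=.
  apply: (char2_not_box_vanishing h2 (size_dehom_homog hf)).
  apply/negPn/negP; rewrite negb_or !negbK => /andP [/eqP I0 /eqP J0].
  apply: h; apply/(in_xy_pow_box _ (dhomogMn _ hf)); rewrite rmorphXn p2 /=.
  exact: (char2_invariants_eq0_box_vanishing h2 (size_dehom_homog hf) I0 J0).
rewrite prednK ?(p_expn_gt0 hp) // expnS natrM p2 mulrA mul1r mulVf ?mul1r //.
by rewrite pnatr_eq0.
Qed.

Lemma reduced_quartic_char2 (f : {mpoly k[2]}) : p = 2%N -> f \is 4.-homog ->
  reduced f -> ~ in_xy_pow (p ^ 3) (f ^+ 3).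
Proof.
move=> p2 hf rf /(in_xy_pow_box _ (dhomogMn 3 hf)); rewrite p2 rmorphXn /= => h.
have h2 : 2%N \in [pchar k] by rewrite -p2.
have sF := size_dehom_homog hf.
have [I0 J0] := char2_box_vanishing_invariants h2 sF h.
have [s3|[t Ft dFt]] := char2_double_root h2 sF I0 J0.
  exact: quartic_size3_not_reduced hf s3 rf.
exact: quartic_double_root_not_reduced hf Ft dFt rf.
Qed.

(** For q = p and degree 4m = 2p - 2 the box has the single index 2m = p - 1. *)
Lemma hasse_coef (m : nat) (f : {mpoly k[2]}) : p = m.*2.+1 -> f \is 4.-homog ->
  in_xy_pow p (f ^+ m) <-> (dehom f ^+ m)`_m.*2 = 0.
Proof.
move=> pE hf; apply: (iff_trans (in_xy_pow_box _ (dhomogMn m hf))); rewrite rmorphXn /=.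
split=> [h|h a a1 a2]; first by apply: h; rewrite pE; lia.
by have -> : a = m.*2 by lia.
Qed.

Lemma fpt_quartic_ordinary (m : nat) (f : {mpoly k[2]}) :
    p = m.*2.+1 -> f \is 4.-homog ->
  ~ in_xy_pow p (f ^+ m) -> fpt R p f = 1 / 2.
Proof.
move=> pE hf /(hasse_coef pE hf) h.
apply/le_anti; rewrite fpt_quartic_le_half //=.
apply: (fpt_ge_lim hp hf) => e; exists (p ^ e.+1)./2.
  have qodd : odd (p ^ e.+1) by rewrite oddX pE /= odd_double.
  have qE := odd_double_half (p ^ e.+1); rewrite qodd in qE.
  move/(in_xy_pow_box _ (dhomogMn _ hf)); rewrite rmorphXn /= => /(_ (p ^ e.+1).-1) H.
  have hm : (dehom f ^+ m)`_p.-1 != 0 by rewrite pE /=; apply/eqP.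
  have := ordinary_coef hp e.+1 pE (size_dehom_homog hf) hm.
  by rewrite H ?eqxx // -qE /=; lia.
have qE := odd_double_half (p ^ e.+1); rewrite mul1r mulrC ler_pdivrMr ?ltr0n //.
by rewrite -natrM ler_nat -{1}qE; case: (odd _); lia.
Qed.

Lemma fpt_quartic_supersingular (m : nat) (f : {mpoly k[2]}) :
    p = m.*2.+1 -> f \is 4.-homog -> reduced f ->
  in_xy_pow p (f ^+ m) -> fpt R p f = m%:R / p%:R.
Proof.
move=> pE hf rf h; set F := dehom f.
have m0 : (0 < m)%N by have := prime_gt1 (pcharf_prime hp); rewrite pE; lia.
have n2 : 2%:R != 0 :> k.
  rewrite -(dvdn_pcharf hp); apply/negP => /dvdn_leq => /(_ isT); rewrite pE; lia.
have n4 : 4%:R != 0 :> k by rewrite (natrM _ 2 2) mulf_neq0.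
have sF : (size F <= 5)%N := size_dehom_homog hf.
set P := F^`(); set Q := F *+ 4 - 'X * F^`().
have P3 : P`_3 = F`_4 *+ 4 by rewrite coef_deriv.
have Q3 : Q`_3 = F`_3.
  by rewrite coefB coefMn coefXM coef_deriv /= (mulrSr _ 3) addrC addKr.
have sP : (size P <= 4)%N.
  apply/leq_sizeP => j hj; rewrite coef_deriv nth_default ?mul0rn //.
  by rewrite (leq_trans sF).
have sQ : (size Q <= 4)%N.
  apply/leq_sizeP => j; rewrite leq_eqVlt => /predU1P [<-|hj].
    by rewrite coefB coefMn coefXM coef_deriv /= subrr.
  rewrite coefB coefMn coefXM coef_deriv !nth_default ?mul0rn ?if_same ?subrr //.
    by rewrite prednK ?(leq_trans sF) // (leq_trans _ hj).
  by rewrite (leq_trans sF).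
(* At a common root of [P] and [Q] also 4F vanishes, so F has a double root there. *)
have cPQ : coprimep P Q.
  apply/Pdiv.ClosedField.coprimepP => t /rootP Pt; apply/eqP => Qt.
  apply: (quartic_double_root_not_reduced hf _ Pt rf).
  move: Qt; rewrite /Q hornerD hornerN hornerM Pt mulr0 subr0 hornerMn -mulr_natr.
  by move/eqP; rewrite mulf_eq0 (negPf n4) orbF => /eqP.
(* If both cubics dropped degree, the coefficients of F at 3 and 4 would vanish and y^2 would divide
   [f]. *)
have sPQ : (size P == 4%N) || (size Q == 4%N).
  apply/negPn/negP; rewrite negb_or !neq_ltn !(ltnNge 4) sP sQ !orbF => /andP [sP' sQ'].
  apply: (quartic_size3_not_reduced hf _ rf); apply/leq_sizeP => j.
  rewrite leq_eqVlt => /predU1P [<-|]; first by rewrite -/F -Q3 nth_default.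
  rewrite leq_eqVlt => /predU1P [<-|hj]; last by rewrite nth_default // (leq_trans sF).
  move/eqP: P3; rewrite nth_default // eq_sym -mulr_natr mulf_eq0 (negPf n4) orbF.
  by move/eqP.
apply/le_anti; apply/andP; split.
  by have := @fpt_le R k p hp 4 m 1 f hf; rewrite expn1; apply.
(* At level p^(e+1), N = m p^e - 1 is the largest exponent excluded by [box_vanishing_lower]. *)
apply: (fpt_ge_lim hp hf) => e; exists (m * p ^ e).-1.
  move/(in_xy_pow_box _ (dhomogMn _ hf)); rewrite rmorphXn /= -/F.
  move/(box_vanishing_lower hp cPQ sP sQ sPQ pE m0); rewrite expnS mulnCA.
  rewrite leq_pmul2l ?(prime_gt0 (pcharf_prime hp)) //.
  by rewrite leqNgt prednK ?leqnn // muln_gt0 m0 (p_expn_gt0 hp).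
rewrite prednK ?muln_gt0 ?m0 ?(p_expn_gt0 hp) // expnS !natrM mulrA divfK //.
by rewrite pnatr_eq0 -lt0n (prime_gt0 (pcharf_prime hp)).
Qed.

End Quartics.

(** * The generic value and the list of values *)

(** A single membership test decides the locus: passing it bounds the threshold by N/p^e < 1/2,
    failing it gives 1/2. So the locus is open, and dense once nonempty. *)
Lemma is_generic_fpt_quartic (R : realType) (k : closedFieldType) (p N e : nat) :
    p \in [pchar k] -> N%:R / (p ^ e)%:R < 1 / 2 :> R ->
    (forall f : {mpoly k[2]}, f \is 4.-homog ->
       ~ in_xy_pow (p ^ e) (f ^+ N) -> fpt R p f = 1 / 2) ->
    (exists f : {mpoly k[2]}, nonzero_form 4 f /\ ~ in_xy_pow (p ^ e) (f ^+ N)) ->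
  is_generic_fpt k p 4 (1 / 2 : R).
Proof.
move=> hp lt12 H ex L.
have -> : L = [set f | nonzero_form 4 f /\ ~ in_xy_pow (p ^ e) (f ^+ N)].
  apply/seteqP; split=> f /= [f0 h]; split=> //.
    move=> hin; have := fpt_le R hp (proj2 f0) hin.
    by rewrite h leNgt lt12.
  exact: H (proj2 f0) h.
have op := zariski_open_not_in_xy_pow k 4 N (p ^ e).
split=> //; first by move=> f [_ hf]; exact: fpt_quartic_le_half.
exact: zariski_open_dense.
Qed.

Lemma pred_half_natr (R : realType) (p m : nat) :
  p = m.*2.+1 -> (p%:R - 1) / (2 * p%:R) = m%:R / p%:R :> R.
Proof.
move=> pE; have p0 : p%:R != 0 :> R by rewrite pnatr_eq0 pE.
have -> : p%:R - 1 = 2 * m%:R :> R by rewrite pE -addn1 natrD addrK -mul2n natrM.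
by rewrite -mulf_div divff ?mul1r // pnatr_eq0.
Qed.

(** All digits of 1/2 equal m = (p - 1)/2, the n-th partial sum being 1/2 - 1/(2 p^n). *)
Lemma is_truncation_half (R : realType) (p m : nat) : p = m.*2.+1 -> (0 < m)%N ->
  is_truncation p (1 / 2 : R) 1 (m%:R / p%:R).
Proof.
move=> pE m0; have p0 : p%:R != 0 :> R by rewrite pnatr_eq0 pE.
have p1 : (1 < p)%N by rewrite pE; lia.
exists (fun=> m); last by rewrite big_ord1 expr1.
split=> [_|n|eps eps0]; first by rewrite pE; lia.
  by exists n; rewrite // -lt0n.
have sumE n : \sum_(i < n) m%:R / p%:R ^+ i.+1 = 1 / 2 - (2 * p%:R ^+ n)^-1 :> R.
  elim: n => [|n IHn]; first by rewrite big_ord0 expr0 mulr1 div1r subrr.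
  rewrite big_ord_recr IHn /=.
  have pER : p%:R = 2 * m%:R + 1 :> R by rewrite pE -addn1 natrD -mul2n natrM.
  have pn0 : p%:R ^+ n != 0 :> R by rewrite expf_neq0.
  have -> : m%:R = (p%:R - 1) / 2 :> R by rewrite pER; field.
  by rewrite exprS; field; rewrite pn0.
exists (Num.truncn eps^-1).+1 => n hn; rewrite sumE addrC addKr normrN ger0_norm.
  have q0 : 0 < 2 * p%:R ^+ n :> R.
    by rewrite mulr_gt0 // exprn_gt0 // ltr0n ltnW.
  rewrite invf_plt ?posrE //; apply: lt_le_trans (truncnS_gt _) _.
  rewrite -natrX -natrM ler_nat (leq_trans hn) //.
  have := ltn_expl n p1; lia.
by rewrite invr_ge0 mulr_ge0 // exprn_ge0.
Qed.

Lemma homogenize_reduced (k : fieldType) (d : nat) (F : {poly k}) :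
    size F = d.+1 -> coprimep F F^`() ->
  [/\ homogenize d F \is d.-homog, dehom (homogenize d F) = F
    & reduced (homogenize d F)].
Proof.
move=> sF cF; have hf := homogenize_homog d F.
have EF : dehom (homogenize d F) = F by rewrite homogenizeK ?sF.
by split=> //; apply: (reduced_of_coprime_deriv hf); rewrite EF.
Qed.

Theorem proposition7p4 (R : realType) (k : closedFieldType) (p : nat)
    (hp : p \in [pchar k]) :
  [/\ is_generic_fpt k p 4 (1 / 2 : R),
      p = 2%N -> forall f : {mpoly k[2]},
        f \is 4.-homog -> reduced f -> fpt R p f = 1 / 2,
      p <> 2%N ->
        is_truncation p (1 / 2 : R) 1 ((p%:R - 1) / (2 * p%:R)) /\
        exists f : {mpoly k[2]},
          [/\ f \is 4.-homog, reduced f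
            & fpt R p f = (p%:R - 1) / (2 * p%:R)]
    & [set r : R | exists f : {mpoly k[2]},
         [/\ f \is 4.-homog, reduced f & fpt R p f = r]]
      = (if p == 2%N then [set 1 / 2 : R]
         else [set (1 / 2 : R); ((p%:R - 1) / (2 * p%:R) : R)])].
Proof.
have pp := pcharf_prime hp.
have [p2|p2] := eqVneq p 2%N.
  have char2 (f : {mpoly k[2]}) : f \is 4.-homog -> reduced f -> fpt R p f = 1 / 2.
    by move=> hf rf; apply: fpt_quartic_char2 => //; exact: reduced_quartic_char2.
  have [f [hf _ rf]] : exists f : {mpoly k[2]},
      [/\ f \is 4.-homog, dehom f = 'X^4 + 'X & reduced f].
    (* In characteristic 2 the derivative of X^4 + X is 1, so coprimality is immediate. *)
    exists (homogenize 4 ('X^4 + 'X)); apply: homogenize_reduced.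
      by rewrite size_polyDl size_polyXn ?size_polyX.
    have h2 : 2%N \in [pchar {poly k}] by rewrite pchar_poly -p2.
    rewrite derivD derivXn derivX /= (_ : 'X^3 *+ 4 = 0) ?add0r ?coprimep1 //.
    by rewrite (mulrnA _ 2 2) mulrn_pchar // mul0rn.
  split=> //.
    (* The test is f^3 against (x^8, y^8), with 3/8 < 1/2. *)
    apply: (@is_generic_fpt_quartic _ _ _ 3 3) => //.
    - rewrite p2 ltr_pdivrMr ?ltr0n // mulrAC ltr_pdivlMr ?ltr0n //.
      by rewrite mul1r -natrM ltr_nat.
    - by move=> g hg; exact: fpt_quartic_char2.
    - exists f; split; first by split=> //; exact: (proj1 rf).
      exact: reduced_quartic_char2.
  apply/seteqP; split=> r /=; first by move=> [g [hg rg <-]]; exact: char2.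
  by move=> ->; exists f; split=> //; exact: char2.
have pE : p = p./2.*2.+1.
  by have := odd_double_half p; case: (even_prime pp) => [/eqP|->]; rewrite ?(negPf p2).
move: (p./2) pE => m pE; have m0 : (0 < m)%N by have := prime_gt1 pp; rewrite pE; lia.
rewrite (pred_half_natr R pE).
have [Fo [sFo cFo ho]] := ordinary_quartic_exists hp pE.
have [Fs [sFs cFs hs]] := supersingular_quartic_exists hp pE.
have [hfo EFo rfo] := homogenize_reduced sFo cFo.
have [hfs EFs rfs] := homogenize_reduced sFs cFs.
set fo := homogenize 4 Fo in hfo EFo rfo; set fs := homogenize 4 Fs in hfs EFs rfs.
have nfo : ~ in_xy_pow p (fo ^+ m).
  by move/(hasse_coef hp pE hfo); rewrite EFo; exact/eqP.
have nfs : in_xy_pow p (fs ^+ m) by apply/(hasse_coef hp pE hfs); rewrite EFs.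
have fpts : fpt R p fs = m%:R / p%:R by exact: fpt_quartic_supersingular.
split=> [|/eqP|_|].
- apply: (@is_generic_fpt_quartic _ _ _ m 1) => //; rewrite expn1.
  + rewrite ltr_pdivrMr ?ltr0n ?prime_gt0 // mulrAC ltr_pdivlMr ?ltr0n //.
    by rewrite mul1r -natrM ltr_nat pE; lia.
  + by move=> g hg; exact: fpt_quartic_ordinary.
  + by exists fo; split=> //; split=> //; exact: (proj1 rfo).
- by rewrite (negPf p2).
- by split; [exact: is_truncation_half|exists fs].
apply/seteqP; split=> r /=.
  move=> [g [hg rg <-]]; have [hin|hin] := EM (in_xy_pow p (g ^+ m)).
    by right; exact: fpt_quartic_supersingular.
  by left; exact: (fpt_quartic_ordinary R hp pE).
move=> [->|->]; last by exists fs.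
by exists fo; split=> //; exact: (fpt_quartic_ordinary R hp pE).
Qed.
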